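(* The kissing number in three dimensions is $k(3)=12$. Equivalently, the maximal number of points that can be placed on the unit sphere $\mathbf{S}^2\subset\mathbb{R}^3$ such that the angular separation between any two distinct points is at least $60^\circ$ equals $12$.
   Context: The kissing number $k(d)$ is the largest number of nonoverlapping unit balls in $\mathbb{R}^d$ that can all touch a given unit ball. Equivalently, it is the largest number of points on the unit sphere $\mathbf{S}^{d-1}$ with pairwise angular (spherical) distance at least $60^\circ$. *)

(* Defs.v *)
From HB Require Import structures.
From mathcomp Require Import all_boot all_order all_algebra.
From mathcomp Require Import reals trigo.
Unset Printing Implicit Defensive.
Import Order.TTheory GRing.Theory Num.Theory.
Local Open Scope ring_scope.

Definition dotv {R : realType} {d : nat} (u v : 'rV[R]_d) : R :=
  \sum_(i < d) u 0 i * v 0 i.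

Definition on_unit_sphere {R : realType} {d : nat} (u : 'rV[R]_d) : Prop :=
  dotv u u = 1.

Definition ang_dist {R : realType} {d : nat} (u v : 'rV[R]_d) : R :=
  acos (dotv u v).

Definition kissing_config {R : realType} (d : nat) (s : seq 'rV[R]_d) : Prop :=
  uniq s /\
  (forall u, u \in s -> on_unit_sphere u) /\
  (forall u v, u \in s -> v \in s -> u != v -> pi / 3%:R <= ang_dist u v).

Definition is_kissing_number {R : realType} (d k : nat) : Prop :=
  (exists s : seq 'rV[R]_d, kissing_config d s /\ size s = k) /\
  (forall s : seq 'rV[R]_d, kissing_config d s -> (size s <= k)%N).

(* Main.v *)
Require Import Defs.
From Stdlib Require Import ZArith.
From mathcomp Require Import all_boot all_order all_algebra.
From mathcomp Require Import reals trigo.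
From mathcomp Require Import ring lra zify ssrZ polyrcf.

(** This is Musin's variant of Delsarte's linear programming bound.  The
polynomial [musin] is 1 plus a nonnegative combination of Legendre polynomials
[P_k], and each [P_k (x . y)] is a positive semidefinite kernel on the sphere,
so the sum of [musin (x . y)] over all pairs of points of a configuration of
size [M] is at least [M ^ 2].  It is therefore enough that every row sum over
[y], for fixed [x], is less than 13.  The diagonal contributes
[musin 1 = 10.11].  As [musin] is nonpositive on [[-23/39, 1/2]], only the
points in the cap of points [y] with [e . y >= 23/39], where [e = - x], can
contribute more.  This cap contains at most four points: the planar Delsarte
bound applies to the directions of their projections to the plane orthogonal to
[e].  Finally, vectors with pairwise inner products at most 1/2 satisfy
[(sum a_i (e . y_i)) ^ 2 <= (sum a_i ^ 2 + (sum a_i) ^ 2) / 2] for all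
nonnegative weights, and a subdivision of the cube of possible values of
[e . y_i] verifies that under these constraints the contribution of the cap is
less than 2.89. *)

Set Implicit Arguments.
Unset Strict Implicit.
Unset Printing Implicit Defensive.
Import Order.TTheory GRing.Theory Num.Theory.
Local Open Scope ring_scope.

(** * Inner products *)

Section InnerProduct.
Variables (R : realType) (d : nat).
Implicit Types x y z : 'rV[R]_d.

Lemma dotvC x y : dotv x y = dotv y x.
Proof. by apply: eq_bigr => i _; rewrite mulrC. Qed.

Lemma dotvDl x y z : dotv (x + y) z = dotv x z + dotv y z.
Proof. by rewrite /dotv -big_split; apply: eq_bigr => i _; rewrite mxE mulrDl. Qed.

Lemma dotvZl a x y : dotv (a *: x) y = a * dotv x y.
Proof. by rewrite /dotv mulr_sumr; apply: eq_bigr => i _; rewrite mxE mulrA. Qed.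

Lemma dot0v x : dotv 0 x = 0.
Proof. by rewrite /dotv big1 // => i _; rewrite mxE mul0r. Qed.

Lemma dotv_ge0 x : 0 <= dotv x x.
Proof. by rewrite /dotv sumr_ge0 // => i _; rewrite -expr2 sqr_ge0. Qed.

Lemma dotv_sqr_le x y : on_unit_sphere x -> dotv x y ^+ 2 <= dotv y y.
Proof.
move=> hx; have := dotv_ge0 (y + (- dotv x y) *: x).
rewrite dotvDl dotvZl ![dotv _ (_ + _)]dotvC !dotvDl !dotvZl (dotvC y x).
by rewrite (hx : dotv x x = 1); lra.
Qed.

Lemma dotv_unit_itv x y : on_unit_sphere x -> on_unit_sphere y -> -1 <= dotv x y <= 1.
Proof.
move=> hx hy; have := dotv_sqr_le y hx; rewrite (hy : dotv y y = 1) => h.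
by apply/andP; split; nra.
Qed.

End InnerProduct.

(** * Positive semidefinite kernels *)

Section Delsarte.
Variable R : realType.

Lemma ler_sum_seq (T : eqType) (s : seq T) (F G : T -> R) :
  (forall x, x \in s -> F x <= G x) -> \sum_(x <- s) F x <= \sum_(x <- s) G x.
Proof. by move=> h; rewrite big_seq [X in _ <= X]big_seq; apply: ler_sum. Qed.

Section PositiveKernels.
Variable T : eqType.
Variable D : T -> Prop.
Implicit Types (K : T -> T -> R) (s : seq T).

(** All weights are 1, up to repetition in the list: the form in which [delsarte_bound] sums over
    pairs. *)
Definition psd K :=
  forall s, (forall x, x \in s -> D x) -> 0 <= \sum_(x <- s) \sum_(y <- s) K x y.

Lemma psd_ext K1 K2 :
  (forall x y, D x -> D y -> K1 x y = K2 x y) -> psd K1 -> psd K2.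
Proof.
move=> eqK hK s hs; apply: le_trans (hK s hs) _; rewrite le_eqVlt; apply/orP; left.
apply/eqP; apply: eq_big_seq => x xs; apply: eq_big_seq => y ys.
by apply: eqK; exact: hs.
Qed.

Lemma psd_add K1 K2 : psd K1 -> psd K2 -> psd (fun x y => K1 x y + K2 x y).
Proof.
move=> h1 h2 s hs; under eq_bigr do rewrite big_split.
by rewrite big_split addr_ge0 ?h1 ?h2.
Qed.

Lemma psd_scale c K : 0 <= c -> psd K -> psd (fun x y => c * K x y).
Proof.
move=> c0 h s hs; under eq_bigr do rewrite -mulr_sumr.
by rewrite -mulr_sumr mulr_ge0 ?h.
Qed.

Lemma psd_rank1 (h : T -> R) : psd (fun x y => h x * h y).
Proof.
move=> s _; under eq_bigr do rewrite -mulr_sumr.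
by rewrite -mulr_suml -expr2 sqr_ge0.
Qed.

(** For $M$ points, summing [K - 1] over all pairs gives $M^2 \le \sum K$, while the row bounds give
    $\sum K < M b$. *)
Lemma delsarte_bound K s (b : R) :
    uniq s -> (forall x, x \in s -> D x) -> psd (fun x y => K x y - 1) ->
    (forall x, x \in s -> \sum_(y <- s) K x y < b) ->
  s != [::] -> (size s)%:R < b.
Proof.
move=> us hs hK hb s0; have := hK s hs.
have m0 : 0 < (size s)%:R :> R by rewrite ltr0n lt0n size_eq0.
have -> : \sum_(x <- s) \sum_(y <- s) (K x y - 1) =
   \sum_(x <- s) \sum_(y <- s) K x y - (size s)%:R * (size s)%:R.
  under eq_bigr do rewrite sumrB; rewrite sumrB; congr (_ - _).
  by rewrite !big_const_seq !count_predT !iter_addr !addr0 mulr_natr.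
have : \sum_(x <- s) \sum_(y <- s) K x y < \sum_(x <- s) b.
  case: s s0 hb {us hs hK m0} => // x s _ hb; rewrite [ltLHS]big_cons [ltRHS]big_cons.
  apply: ltr_leD; first by rewrite hb ?mem_head.
  by apply: ler_sum_seq => y ys; rewrite ltW// hb// in_cons ys orbT.
rewrite big_const_seq count_predT iter_addr addr0 -[b *+ _]mulr_natr => h1 h2.
by rewrite -(ltr_pM2r m0); apply: le_lt_trans h1; rewrite -subr_ge0.
Qed.

End PositiveKernels.

(** * Harmonic kernels on the sphere and Legendre polynomials *)

Definition rvcoord (k : nat) (u : 'rV[R]_3) : R := u 0 (inord k).

Lemma dotv3E (u v : 'rV[R]_3) :
  dotv u v = rvcoord 0 u * rvcoord 0 v + rvcoord 1 u * rvcoord 1 v + rvcoord 2 u * rvcoord 2 v.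
Proof.
rewrite /dotv !big_ord_recl big_ord0 addr0 addrA /rvcoord.
by do !congr (_ + _); congr (u 0 _ * v 0 _); apply: val_inj; rewrite /= inordK.
Qed.

Local Notation unitv := (@on_unit_sphere R 3).

(** The real and imaginary parts of $(a + ib)^m$. *)
Fixpoint planar_power m (a b : R) : R * R :=
  if m is m'.+1 then
    let: (u, v) := planar_power m' a b in (a * u - b * v, a * v + b * u)
  else (1, 0).

(* [homog_cheb m p r] is the Chebyshev polynomial [T_m] made homogeneous: it
expresses [Re ((z w^* ) ^ m)] through [p = Re (z w^* )] and [r = |z w| ^ 2]. *)
Fixpoint homog_cheb2 m (p r : R) : R * R :=
  if m is m'.+1 then
    let: (c, d) := homog_cheb2 m' p r in (d, 2 * p * d - r * c)
  else (1, p).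
Definition homog_cheb m p r := (homog_cheb2 m p r).1.

Lemma homog_chebE m (a b c d : R) :
  homog_cheb m (a * c + b * d) ((a ^+ 2 + b ^+ 2) * (c ^+ 2 + d ^+ 2)) =
  (planar_power m a b).1 * (planar_power m c d).1 +
  (planar_power m a b).2 * (planar_power m c d).2.
Proof.
rewrite /homog_cheb.
pose K m := (planar_power m a b).1 * (planar_power m c d).1 +
  (planar_power m a b).2 * (planar_power m c d).2.
(* The recurrence has order two, so the induction carries two consecutive values. *)
suff -> : homog_cheb2 m (a * c + b * d) ((a ^+ 2 + b ^+ 2) * (c ^+ 2 + d ^+ 2))
   = (K m, K m.+1) by [].
elim: m => [|m IH]; first by rewrite /K /=; congr (_, _); ring.
rewrite [LHS]/= IH {IH} /K; congr (_, _); rewrite /=.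
by case: (planar_power m a b) => u v; case: (planar_power m c d) => u' v' /=; ring.
Qed.

(** On the sphere $1 - z^2$ is the squared length of the horizontal projection. Writing it this way
    keeps the kernel polynomial in heights and horizontal inner product, so that [field] can check
    the addition theorems. *)
Definition zonal m (q : R -> R) (u v : 'rV[R]_3) : R :=
  q (rvcoord 2 u) * q (rvcoord 2 v) *
  homog_cheb m (rvcoord 0 u * rvcoord 0 v + rvcoord 1 u * rvcoord 1 v)
    ((1 - rvcoord 2 u ^+ 2) * (1 - rvcoord 2 v ^+ 2)).

Lemma psd_zonal m q : psd unitv (zonal m q).
Proof.
pose h1 u := q (rvcoord 2 u) * (planar_power m (rvcoord 0 u) (rvcoord 1 u)).1.
pose h2 u := q (rvcoord 2 u) * (planar_power m (rvcoord 0 u) (rvcoord 1 u)).2.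
apply: psd_ext (psd_add (@psd_rank1 _ _ h1) (@psd_rank1 _ _ h2)).
move=> u v; rewrite /on_unit_sphere !dotv3E => hu hv; rewrite /zonal.
have -> : 1 - rvcoord 2 u ^+ 2 = rvcoord 0 u ^+ 2 + rvcoord 1 u ^+ 2 by rewrite -hu; ring.
have -> : 1 - rvcoord 2 v ^+ 2 = rvcoord 0 v ^+ 2 + rvcoord 1 v ^+ 2 by rewrite -hv; ring.
by rewrite homog_chebE /h1 /h2; ring.
Qed.

Fixpoint zonal_series m (l : seq (R * (R -> R))) (u v : 'rV[R]_3) : R :=
  if l is (c, q) :: l' then c * zonal m q u v + zonal_series m.+1 l' u v else 0.

Lemma psd_zonal_series m l :
  all (fun cq => 0 <= cq.1) l -> psd unitv (zonal_series m l).
Proof.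
elim: l m => [m _ s _|[c q] l IH m /= /andP[c0 hl]].
  by rewrite big1 // => x _; rewrite big1.
exact: psd_add (psd_scale c0 (@psd_zonal m q)) (IH m.+1 hl).
Qed.

(* In the lemmas below, the sum over [m] is the addition theorem for [P_n]: up to
rescaling, its [m]-th entry is [((2 - (m == 0)) (n - m)! / (n + m)!, P_n^`(m))].
Large numerals are factored because numerals of a ring are unary naturals. *)
Definition legendre2 (t : R) : R := (3 * t ^+ 2 - 1) / 2.

Lemma psd_legendre2 : psd unitv (fun u v => legendre2 (dotv u v)).
Proof.
apply: psd_ext (@psd_zonal_series 0 [::
    (1 / 4, fun a => 3 * a ^+ 2 - 1);
    (3, fun a => a);
    (3 / 4, fun _ => 1)] _).
  by move=> u v _ _; rewrite dotv3E /legendre2 /= /zonal /homog_cheb /=; field.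
by rewrite /= ?(divr_ge0, mulr_ge0, exprn_ge0, ler0n, ler01).
Qed.

Definition legendre3 (t : R) : R := (5 * t ^+ 3 - 3 * t) / 2.

Lemma psd_legendre3 : psd unitv (fun u v => legendre3 (dotv u v)).
Proof.
apply: psd_ext (@psd_zonal_series 0 [::
    (1 / 4, fun a => 5 * a ^+ 3 - 3 * a);
    (3 / 8, fun a => 5 * a ^+ 2 - 1);
    (15 / 4, fun a => a);
    (5 / 8, fun _ => 1)] _).
  by move=> u v _ _; rewrite dotv3E /legendre3 /= /zonal /homog_cheb /=; field.
by rewrite /= ?(divr_ge0, mulr_ge0, exprn_ge0, ler0n, ler01).
Qed.

Definition legendre4 (t : R) : R := (35 * t ^+ 4 - 30 * t ^+ 2 + 3) / 8.

Lemma psd_legendre4 : psd unitv (fun u v => legendre4 (dotv u v)).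
Proof.
apply: psd_ext (@psd_zonal_series 0 [::
    (1 / 64, fun a => 35 * a ^+ 4 - 30 * a ^+ 2 + 3);
    (5 / 8, fun a => 7 * a ^+ 3 - 3 * a);
    (5 / 16, fun a => 7 * a ^+ 2 - 1);
    (35 / 8, fun a => a);
    (35 / 64, fun _ => 1)] _).
  by move=> u v _ _; rewrite dotv3E /legendre4 /= /zonal /homog_cheb /=; field.
by rewrite /= ?(divr_ge0, mulr_ge0, exprn_ge0, ler0n, ler01).
Qed.

Definition legendre5 (t : R) : R := (63 * t ^+ 5 - 70 * t ^+ 3 + 15 * t) / 8.

Lemma psd_legendre5 : psd unitv (fun u v => legendre5 (dotv u v)).
Proof.
apply: psd_ext (@psd_zonal_series 0 [::
    (1 / 64, fun a => 63 * a ^+ 5 - 70 * a ^+ 3 + 15 * a);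
    (15 / 64, fun a => 21 * a ^+ 4 - 14 * a ^+ 2 + 1);
    (105 / 16, fun a => 3 * a ^+ 3 - a);
    (35 / 128, fun a => 9 * a ^+ 2 - 1);
    (315 / 64, fun a => a);
    (63 / 128, fun _ => 1)] _).
  by move=> u v _ _; rewrite dotv3E /legendre5 /= /zonal /homog_cheb /=; field.
by rewrite /= ?(divr_ge0, mulr_ge0, exprn_ge0, ler0n, ler01).
Qed.

Definition legendre9 (t : R) : R :=
  (715 * 17 * t ^+ 9 - 495 * 13 * 2 ^+ 2 * t ^+ 7 + 693 * 13 * 2 * t ^+ 5
   - 105 * 11 * 2 ^+ 2 * t ^+ 3 + 315 * t) / 128.

Lemma psd_legendre9 : psd unitv (fun u v => legendre9 (dotv u v)).
Proof.
apply: psd_ext (@psd_zonal_series 0 [::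
    (1 / 2 ^+ 14, fun a => 715 * 17 * a ^+ 9 - 495 * 13 * 2 ^+ 2 * a ^+ 7
       + 693 * 13 * 2 * a ^+ 5 - 105 * 11 * 2 ^+ 2 * a ^+ 3 + 315 * a);
    (45 / 2 ^+ 14, fun a => 143 * 17 * a ^+ 8 - 77 * 13 * 2 ^+ 2 * a ^+ 6
       + 77 * 13 * 2 * a ^+ 4 - 308 * a ^+ 2 + 7);
    (495 / 2 ^+ 11, fun a => 221 * a ^+ 7 - 273 * a ^+ 5 + 91 * a ^+ 3 - 7 * a);
    ((105 * 11) / 2 ^+ 13, fun a => 221 * a ^+ 6 - 195 * a ^+ 4 + 39 * a ^+ 2 - 1);
    ((315 * 143) / 2 ^+ 12, fun a => 17 * a ^+ 5 - 10 * a ^+ 3 + a);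
    ((99 * 13) / 2 ^+ 13, fun a => 85 * a ^+ 4 - 30 * a ^+ 2 + 1);
    ((165 * 13) / 2 ^+ 11, fun a => 17 * a ^+ 3 - 3 * a);
    ((495 * 13) / 2 ^+ 15, fun a => 17 * a ^+ 2 - 1);
    ((495 * 221) / 2 ^+ 14, fun a => a);
    ((715 * 17) / 2 ^+ 15, fun _ => 1)] _).
  by move=> u v _ _; rewrite dotv3E /legendre9 /= /zonal /homog_cheb /=; field.
by rewrite /= ?(divr_ge0, mulr_ge0, exprn_ge0, ler0n, ler01).
Qed.

End Delsarte.

(** * Musin's polynomial *)

Section Musin.
Variable R : realType.
Local Notation unitv := (@on_unit_sphere R 3).

Definition musin (t : R) : R :=
  2431 / 80 * t ^+ 9 - 1287 / 20 * t ^+ 7 + 27 * 679 / 400 * t ^+ 5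
  + 343 / 40 * t ^+ 4 - 83 / 10 * t ^+ 3 - 213 / 100 * t ^+ 2 + t / 10 - 1 / 200.

(** The Legendre coefficients after the constant 1 are all positive. The nesting follows the order
    of [psd_add] in [psd_musin]. *)
Lemma musin_legendre t :
  musin t = 1 + (8 / 5 * t + (87 / 25 * legendre2 t + (33 / 20 * legendre3 t +
    (49 / 25 * legendre4 t + (1 / 10 * legendre5 t + 8 / 25 * legendre9 t))))).
Proof.
by rewrite /musin /legendre2 /legendre3 /legendre4 /legendre5 /legendre9; field.
Qed.

Lemma psd_dotv : psd unitv (@dotv R 3).
Proof.
have h k : psd unitv (fun u v => rvcoord k u * rvcoord k v) by exact: psd_rank1.
apply: psd_ext (psd_add (psd_add (h 0%N) (h 1%N)) (h 2%N)).
by move=> u v _ _; rewrite dotv3E.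
Qed.

Lemma psd_musin : psd unitv (fun u v => musin (dotv u v) - 1).
Proof.
have hL c (L : R -> R) : psd unitv (fun u v => L (dotv u v)) -> 0 <= c ->
  psd unitv (fun u v => c * L (dotv u v)) by move=> hL c0; apply: psd_scale.
have h1 := hL (8 / 5) id psd_dotv ltac:(lra).
have h2 := hL (87 / 25) _ (@psd_legendre2 R) ltac:(lra).
have h3 := hL (33 / 20) _ (@psd_legendre3 R) ltac:(lra).
have h4 := hL (49 / 25) _ (@psd_legendre4 R) ltac:(lra).
have h5 := hL (1 / 10) _ (@psd_legendre5 R) ltac:(lra).
have h9 := hL (8 / 25) _ (@psd_legendre9 R) ltac:(lra).
apply: psd_ext (psd_add h1 (psd_add h2 (psd_add h3 (psd_add h4 (psd_add h5 h9))))).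
by move=> u v _ _; rewrite musin_legendre addrAC subrr add0r.
Qed.

Lemma musin1 : musin 1 = 1011 / 100.
Proof. by rewrite /musin; field. Qed.

(** Bernstein products, once among the hypotheses, let [lra] settle the sign of a polynomial on an
    interval as a linear problem in its monomials. *)
Lemma bernstein_ge0 (a b t : R) i j : a <= t -> t <= b -> 0 <= (t - a) ^+ i * (b - t) ^+ j.
Proof. by move=> h1 h2; rewrite mulr_ge0 ?exprn_ge0 ?subr_ge0. Qed.

Lemma musin_homog (n t : R) : n != 0 ->
  musin t = (715 * 17 * (n * t) ^+ 9 - 36 * 715 * n ^+ 2 * (n * t) ^+ 7
    + 27 * 679 * n ^+ 4 * (n * t) ^+ 5 + 343 * 10 * n ^+ 5 * (n * t) ^+ 4
    - 332 * 10 * n ^+ 6 * (n * t) ^+ 3 - 852 * n ^+ 7 * (n * t) ^+ 2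
    + 40 * n ^+ 8 * (n * t) - 2 * n ^+ 9) / (400 * n ^+ 9).
Proof. by move=> n0; rewrite /musin; field. Qed.

(* All Bernstein coefficients of [musin] on each of these intervals are
nonpositive.  The rescaling makes the endpoints integers. *)
Lemma musin_le0_piece (n a b : R) :
  (n, a, b) \in [:: (39, - 23, - 17); (39, - 17, 0); (5, 0, 2); (10, 4, 5)] ->
  forall t, a <= n * t -> n * t <= b -> musin t <= 0.
Proof.
move=> hab t h1 h2.
have n0 : 0 < n by move: hab; rewrite !inE => /or4P[] /eqP[-> _ _]; rewrite ltr0n.
rewrite (@musin_homog n) ?gt_eqF // ler_pdivrMr ?mulr_gt0 ?exprn_gt0 ?ltr0n // mul0r.
have B i j := @bernstein_ge0 a b (n * t) i j h1 h2.
have := (B 0 9, B 1 8, B 2 7, B 3 6, B 4 5, B 5 4, B 6 3, B 7 2, B 8 1, B 9 0)%N.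
move=> [[[[[[[[[]]]]]]]]].
move: {n0 h1 h2 B} hab (n * t) => hab x.
move: hab; rewrite !inE => /or4P[] /eqP[-> -> ->] => *; lra.
Qed.

Lemma musin_le0 t : - (23 / 39) <= t -> t <= 1 / 2 -> musin t <= 0.
Proof.
move=> h1 h2; case: (lerP (39 * t) (- 17)) => [ha|/ltW ha].
  by apply: (@musin_le0_piece 39 (- 23) (- 17)) ha; [rewrite !inE eqxx | lra].
case: (lerP t 0) => hb.
  by apply: (@musin_le0_piece 39 (- 17) 0) ha _; [rewrite !inE eqxx ?orbT | lra].
case: (lerP (5 * t) 2) => hc.
  by apply: (@musin_le0_piece 5 0 2) hc; [rewrite !inE eqxx ?orbT | lra].
by apply: (@musin_le0_piece 10 4 5); [rewrite !inE eqxx ?orbT | lra | lra].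
Qed.

(** The derivative of $t \mapsto$ [musin (- t)] is a nonnegative combination of the degree 8
    Bernstein products on $[23/39, 1]$. *)
Lemma musin_nonincreasing (x y : R) :
  23 / 39 <= x -> x <= y -> y <= 1 -> musin (- x) <= musin (- y).
Proof.
move=> h1 h2 h3.
pose p : {poly R} := - (2431 / 80) *: 'X^9 + 1287 / 20 *: 'X^7 - (27 * 679 / 400) *: 'X^5
  + 343 / 40 *: 'X^4 + 83 / 10 *: 'X^3 - 213 / 100 *: 'X^2 - 1 / 10 *: 'X - (1 / 200)%:P.
have pE t : p.[t] = musin (- t).
  by rewrite /p !(hornerD, hornerN, hornerZ, hornerXn, hornerX, hornerC) /musin; ring.
rewrite -!pE; apply: (@ler_hornerW _ (23 / 39) 1); rewrite ?in_itv /= ?h1 ?h2 //; last first.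
- by rewrite (le_trans h1).
- by rewrite (le_trans h2).
move=> t; rewrite in_itv /= => /andP[/ltW ta /ltW tb].
have B i j := @bernstein_ge0 (23 / 39) 1 t i j ta tb.
have := (B 0 8, B 1 7, B 2 6, B 3 5, B 4 4, B 5 3, B 6 2, B 7 1, B 8 0)%N.
move=> [[[[[[[[]]]]]]]].
rewrite /p !(derivD, derivN, derivZ, derivXn, derivX, derivC) /=.
rewrite !(hornerD, hornerN, hornerZ, hornerMn, hornerXn, hornerX, hornerC) => *; lra.
Qed.

End Musin.

(** * The opposite cap contains at most four points *)

Section Cap.
Variable R : realType.
Local Notation unitv := (@on_unit_sphere R 3).
Implicit Types (e x y : 'rV[R]_3) (s : seq 'rV[R]_3).

Lemma orthonormal_frame e : unitv e ->
  exists u v : 'rV[R]_3 -> R,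
    forall x y, dotv x y = dotv e x * dotv e y + u x * u y + v x * v y.
Proof.
rewrite /on_unit_sphere dotv3E.
set a := rvcoord 0 e; set b := rvcoord 1 e; set c := rvcoord 2 e => he.
have hn : a * a + b * b = 1 - c * c by rewrite -he; ring.
(* The general frame divides by $1 + c$; the exception is $e = (0, 0, -1)$. *)
have [c1|c1] := eqVneq (1 + c) 0.
  have hc : c = -1 by lra.
  have [ha hb] : a = 0 /\ b = 0.
    have : a * a + b * b = 0 by rewrite hn hc; ring.
    move/eqP; rewrite -!expr2 paddr_eq0 ?sqr_ge0 // !sqrf_eq0.
    by move=> /andP[/eqP-> /eqP->].
  exists (rvcoord 0), (rvcoord 1) => x y.
  by rewrite !dotv3E -/a -/b -/c ha hb hc; ring.
(* The coordinates are taken along the images of the first two basis vectors under the shortest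
   rotation that carries the third one to [e]. *)
pose s x := a * rvcoord 0 x + b * rvcoord 1 x.
pose w x := rvcoord 2 x + s x / (1 + c).
exists (fun x => rvcoord 0 x - a * w x), (fun x => rvcoord 1 x - b * w x) => x y.
have -> : (dotv e x * dotv e y + (rvcoord 0 x - a * w x) * (rvcoord 0 y - a * w y)
     + (rvcoord 1 x - b * w x) * (rvcoord 1 y - b * w y)) =
  (s x + c * rvcoord 2 x) * (s y + c * rvcoord 2 y) + rvcoord 0 x * rvcoord 0 y
  + rvcoord 1 x * rvcoord 1 y - s x * w y - s y * w x + (a * a + b * b) * w x * w y.
  by rewrite !dotv3E -/a -/b -/c /s; ring.
by rewrite hn dotv3E /w; move: (s x) (s y) => sx sy; field.
Qed.

Lemma psd_circle (T : eqType) (U V : T -> R) m :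
  psd (fun i => U i ^+ 2 + V i ^+ 2 = 1)
      (fun i j => homog_cheb m (U i * U j + V i * V j) 1).
Proof.
pose h1 i := (planar_power m (U i) (V i)).1.
pose h2 i := (planar_power m (U i) (V i)).2.
apply: psd_ext (psd_add (@psd_rank1 _ _ _ h1) (@psd_rank1 _ _ _ h2)) => i j hx hy.
by rewrite -homog_chebE hx hy mulr1.
Qed.

(* The factor 200/103 makes the mean over the circle equal to 1; the value at 1
is 486/103 < 5. *)
Definition circle_poly (c : R) := 200 / 103 * ((c - 1 / 4) * (c + 4 / 5) ^+ 2).

Lemma psd_circle_poly (T : eqType) (U V : T -> R) :
  psd (fun i => U i ^+ 2 + V i ^+ 2 = 1)
      (fun i j => circle_poly (U i * U j + V i * V j) - 1).
Proof.
have h c m : 0 <= c -> psd (fun i => U i ^+ 2 + V i ^+ 2 = 1)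
  (fun i j => c * homog_cheb m (U i * U j + V i * V j) 1).
  by move=> c0; apply: psd_scale c0 _; exact: psd_circle.
(* $99/100$, $27/40$ and $1/4$ are the coefficients of $T_1, T_2, T_3$ in $(c - 1/4)(c + 4/5)^2$;
   the constant one is $103/200$. *)
have h1 := h (200 / 103 * (99 / 100)) 1%N ltac:(lra).
have h2 := h (200 / 103 * (27 / 40)) 2%N ltac:(lra).
have h3 := h (200 / 103 * (1 / 4)) 3%N ltac:(lra).
apply: psd_ext (psd_add h1 (psd_add h2 h3)) => i j _ _.
by rewrite /circle_poly /homog_cheb /=; field.
Qed.

(* In the application [n] and [n'] are the lengths of the projections of two
points of the cap: the projections form an angle of cosine at most 1/4. *)
Lemma cap_cos_le (t t' n n' : R) :
  23 / 39 <= t -> 23 / 39 <= t' -> 0 <= n -> 0 <= n' ->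
  n ^+ 2 = 1 - t ^+ 2 -> n' ^+ 2 = 1 - t' ^+ 2 -> 1 / 2 - t * t' <= n * n' / 4.
Proof.
move=> ht ht' n0 n0' hn hn'.
case: (lerP (1 / 2) (t * t')) => [h|/ltW h].
  by have := mulr_ge0 n0 n0'; lra.
suff : 2 - 4 * (t * t') <= n * n' by lra.
rewrite -ler_sqr ?nnegrE ?mulr_ge0 //; last by lra.
rewrite [X in _ <= X]exprMn hn hn'.
have h1 : (23 / 39) ^+ 2 <= t * t' by rewrite expr2 ler_pM //; lra.
have s1 : 0 <= t ^+ 2 - (23 / 39) ^+ 2 by rewrite subr_ge0 ler_sqr ?nnegrE //; lra.
have s2 : 0 <= t' ^+ 2 - (23 / 39) ^+ 2 by rewrite subr_ge0 ler_sqr ?nnegrE //; lra.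
(* With $p = t t'$ and $q = (23/39)^2$, [hQ] bounds $t^2 + t'^2$ by $(p^2 + q^2)/q$. What remains is
   a concave quadratic in $p$, nonnegative at both ends of $[q, 1/2]$; [hP] supplies the range of
   $p$. *)
have hQ := mulr_ge0 s1 s2.
have hP : 0 <= (t * t' - (23 / 39) ^+ 2) * (1 / 2 - t * t').
  by rewrite mulr_ge0 ?subr_ge0.
lra.
Qed.

Lemma cap_size_le4 e s :
    unitv e -> uniq s -> (forall x, x \in s -> unitv x) ->
    (forall x y, x \in s -> y \in s -> x != y -> dotv x y <= 1 / 2) ->
    (forall x, x \in s -> 23 / 39 <= dotv e x) ->
  (size s <= 4)%N.
Proof.
move=> he us hs hsep hcap; rewrite leqNgt; apply/negP => s5.
have [u [v huv]] := orthonormal_frame he.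
have norm x : x \in s -> u x ^+ 2 + v x ^+ 2 = 1 - dotv e x ^+ 2.
  by move=> xs; have := huv x x; rewrite (hs x xs : dotv x x = 1) => ->; ring.
have lt1 x : x \in s -> 0 < 1 - dotv e x ^+ 2.
  move=> xs; have c0 := hcap x xs; have /andP[_ c1] := dotv_unit_itv he (hs x xs).
  rewrite subr_gt0 expr_lt1 //; last by lra.
  rewrite lt_neqAle c1 andbT; apply/eqP => ex.
  (* If [x] were [e], its projection could not be normalized; but then any other point [y] of the
     cap would satisfy $x \cdot y \ge 23/39 > 1/2$. *)
  have /hasP[y ys yx] : has (predC1 x) s.
    apply/negPn/negP => /hasPn h.
    have : (size s <= size [:: x])%N.
      by apply: uniq_leq_size => // y /h /= /negbNE; rewrite inE.
    by rewrite leqNgt (leq_trans _ s5).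
  have := norm x xs; rewrite ex expr1n subrr => /eqP.
  rewrite paddr_eq0 ?sqr_ge0 // !sqrf_eq0 => /andP[/eqP ux /eqP vx].
  have := hsep x y xs ys; rewrite eq_sym huv ex ux vx => /(_ yx).
  by have := hcap y ys; lra.
pose n x := Num.sqrt (1 - dotv e x ^+ 2).
have n_gt0 x : x \in s -> 0 < n x by move=> xs; rewrite sqrtr_gt0 lt1.
have n_sqr x : x \in s -> n x ^+ 2 = 1 - dotv e x ^+ 2.
  by move=> xs; rewrite sqr_sqrtr // ltW ?lt1.
pose U x := u x / n x; pose V x := v x / n x.
have UV1 x : x \in s -> U x ^+ 2 + V x ^+ 2 = 1.
  move=> xs; have n0 := n_gt0 x xs.
  by rewrite !expr_div_n -mulrDl norm // -n_sqr // divff // expf_neq0 // gt_eqF.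
have s0 : s != [::] by case: (s) s5.
have : (size s)%:R < 5%:R :> R.
  apply: (delsarte_bound us UV1 (psd_circle_poly (U := U) (V := V))) s0 => x xs.
  rewrite (bigD1_seq x) //=.
  have -> : U x * U x + V x * V x = 1 by rewrite -!expr2 UV1.
  suff : \sum_(y <- s | y != x) circle_poly (U x * U y + V x * V y) <= 0.
    by rewrite [X in X + _]/circle_poly; lra.
  rewrite big_seq_cond sumr_le0 // => y /andP[ys yx].
  suff hc : U x * U y + V x * V y <= 1 / 4.
    rewrite /circle_poly mulr_ge0_le0 //; first by lra.
    by rewrite mulr_le0_ge0 ?sqr_ge0 ?subr_le0.
  have -> : U x * U y + V x * V y = (u x * u y + v x * v y) / (n x * n y).
    by rewrite /U /V; field; rewrite !gt_eqF ?n_gt0.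
  rewrite ler_pdivrMr ?mulr_gt0 ?n_gt0 //.
  have := @cap_cos_le (dotv e x) (dotv e y) (n x) (n y) (hcap x xs) (hcap y ys)
    (ltW (n_gt0 x xs)) (ltW (n_gt0 y ys)) (n_sqr x xs) (n_sqr y ys).
  have := hsep x y xs ys; rewrite eq_sym => /(_ yx); rewrite huv; lra.
by rewrite ltr_nat ltnNge s5.
Qed.

End Cap.

(** * The contribution of the opposite cap *)

Section Checker.
Local Open Scope Z_scope.

(** Since $312 = 8 \cdot 39$, the cap starts at $184/312 = 23/39$ and spans $128 = 2^7$ grid steps,
    so seven halvings reach the unit grid. *)
Definition musin_num (k : Z) : Z :=
  let N := 312 in
  ((((((-(715 * 17) * k * k + 36 * 715 * (N * N)) * k * k
    - 27 * 679 * (N * N * N * N)) * k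
    + 343 * 10 * (N * N * N * N * N)) * k
    + 332 * 10 * (N * N * N * N * N * N)) * k
    - 852 * (N * N * N * N * N * N * N)) * k
    - 40 * (N * N * N * N * N * N * N * N)) * k
    - 2 * (N * N * N * N * N * N * N * N * N).

Definition musin_den : Z := 4 * 100 * (312 * 312 * 312 * 312 * 312 * 312 * 312 * 312 * 312).

(** The division rounds down, so adding 1 gives an upper bound. The 129 entries include both ends of
    the cap. *)
Definition musin_table : seq Z := Eval vm_compute in
  [seq musin_num (184 + Z.of_nat i) * 1000 / musin_den + 1 | i <- iota 0 129].

(* The default value is at least [1000 * musin (- 1) = 2770]. *)
Definition musin_ub (k : Z) : Z := nth 2890 musin_table (Z.to_nat (k - 184)).

(* In what follows a list [l] and a width [w] stand for the box of the vectors [t]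
such that [l_i <= 312 t_i <= l_i + w]; the cap is [184 <= 312 t <= 184 + 2 ^ 7]. *)
Definition sumZ : seq Z -> Z := foldr Z.add 0.

Fixpoint dotZ (a l : seq Z) : Z :=
  match a, l with x :: a', y :: l' => x * y + dotZ a' l' | _, _ => 0 end.

(* The weights that give the best bound: proportional to the inverse of the
extremal Gram matrix, with 1 on the diagonal and 1/2 elsewhere, applied to [l]. *)
Definition gram_weights (l : seq Z) : seq Z :=
  let p := sumZ l in let m := Z.of_nat (size l).+1 in
  [seq Z.max 0 (m * x - p) | x <- l].

(** Negates the weighted inequality, with denominators cleared. As the weights are nonnegative,
    testing the lower corner rules out the whole box. *)
Definition gram_infeasible (l : seq Z) : bool :=
  let a := gram_weights l in
  let x := dotZ a l in let p := sumZ a in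
  312 * 312 * (dotZ a a + p * p) <? 2 * (x * x).

(** Symmetry breaking: such a box contains no nondecreasing vector. *)
Fixpoint unsorted (w : Z) (l : seq Z) : bool :=
  if l is x :: l' then (if l' is y :: _ then y + w <? x else false) || unsorted w l'
  else false.

(* The nested conditionals, unlike [||], are lazy in call-by-value evaluation. *)
Definition pruned (w : Z) (l : seq Z) : bool :=
  if unsorted w l then true else
  if sumZ [seq musin_ub (x + w) | x <- l] <? 2890 then true else gram_infeasible l.

Fixpoint subboxes (h : Z) (l : seq Z) : seq (seq Z) :=
  if l is x :: l' then
    let r := subboxes h l' in [seq x :: c | c <- r] ++ [seq x + h :: c | c <- r]
  else [:: [::]].

Fixpoint Zpow2 (n : nat) : Z := if n is n'.+1 then 2 * Zpow2 n' else 1.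

(** [n] serves both as recursion bound and as logarithm of the width; boxes of width 1 have to be
    pruned outright. *)
Fixpoint cap_check (n : nat) (l : seq Z) : bool :=
  if pruned (Zpow2 n) l then true else
  if n is n'.+1 then all (cap_check n') (subboxes (Zpow2 n') l) else false.

Definition cap_lo : Z := 184.

Lemma cap_check_le4 : all (fun m => cap_check 7 (nseq m cap_lo)) [:: 1; 2; 3; 4]%N.
Proof. by vm_cast_no_check (erefl true). Qed.

(** Certifies the table entry by entry, which avoids reasoning about the rounding. *)
Lemma musin_table_ok :
  all (fun i => musin_num (184 + Z.of_nat i) * 1000 <=? nth 2890 musin_table i * musin_den)
    (iota 0 129).
Proof. by vm_cast_no_check (erefl true). Qed.

End Checker.

(** * Soundness of the subdivision *)

Section Soundness.
Variable R : realType.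
Local Notation unitv := (@on_unit_sphere R 3).

Definition zr (z : Z) : R := (int_of_Z z)%:~R.

Lemma zrD x y : zr (Z.add x y) = zr x + zr y.
Proof. by rewrite /zr -intrD; congr _%:~R; lia. Qed.

Lemma zrM x y : zr (Z.mul x y) = zr x * zr y.
Proof. by rewrite /zr -intrM; congr _%:~R; lia. Qed.

Lemma zrN x : zr (Z.opp x) = - zr x.
Proof. by rewrite /zr -mulrNz; congr _%:~R; lia. Qed.

Lemma zrB x y : zr (Z.sub x y) = zr x - zr y.
Proof. by rewrite -zrN -zrD. Qed.

Lemma zr_nat n : zr (Z.of_nat n) = n%:R.
Proof. by rewrite /zr (_ : int_of_Z (Z.of_nat n) = n) //; lia. Qed.

Lemma ler_zr x y : (zr x <= zr y) = Z.leb x y.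
Proof. by rewrite /zr ler_int; lia. Qed.

Lemma ltr_zr x y : (zr x < zr y) = Z.ltb x y.
Proof. by rewrite /zr ltr_int; lia. Qed.

Lemma musin_numE k :
  zr (musin_num k) = zr musin_den * musin (- (zr k / 312)).
Proof.
(* The literals of [Z] are binary and those of [R] unary, so each one is translated explicitly. *)
have h n : zr (Z.of_nat n) = n%:R := zr_nat n.
have z312 := h 312%N; have z715 := h 715%N; have z17 := h 17%N; have z36 := h 36%N.
have z27 := h 27%N; have z679 := h 679%N; have z343 := h 343%N; have z10 := h 10%N.
have z332 := h 332%N; have z852 := h 852%N; have z40 := h 40%N; have z2 := h 2%N.
have z4 := h 4%N; have z100 := h 100%N.
rewrite /musin_num /musin_den /musin !(zrD, zrB, zrN, zrM).
rewrite /= in z312 z715 z17 z36 z27 z679 z343 z10 z332 z852 z40 z2 z4 z100.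
rewrite z312 z715 z17 z36 z27 z679 z343 z10 z332 z852 z40 z2 z4 z100.
by move: (zr k) => x; field.
Qed.

Lemma musin_ub_ge k (t : R) :
  23 / 39 <= t -> t <= 1 -> 312 * t <= zr k -> 1000 * musin (- t) <= zr (musin_ub k).
Proof.
move=> t0 t1 tk.
have z184 : zr 184 = 184 := zr_nat 184.
have k184 : zr 184 <= zr k by rewrite z184; lra.
rewrite ler_zr in k184.
have kE : k = Z.add 184 (Z.of_nat (Z.to_nat (Z.sub k 184))) by lia.
rewrite /musin_ub; set i := Z.to_nat _ in kE *.
case: (ltnP i 129) => hi.
  have /allP/(_ i) := musin_table_ok; rewrite mem_iota hi => /(_ isT).
  rewrite -kE -ler_zr (zrM (musin_num k)) musin_numE (zrM (nth _ _ _)).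
  have -> : zr 1000 = 1000 := zr_nat 1000.
  have d0 : zr 0 < zr musin_den by rewrite ltr_zr.
  rewrite [zr 0](zr_nat 0) in d0.
  rewrite -mulrA [leRHS]mulrC ler_pM2l // [_ * 1000]mulrC => h; apply: le_trans h.
  rewrite ler_pM2l ?ltr0n //; apply: musin_nonincreasing => //.
    by rewrite ler_pdivlMr ?ltr0n // mulrC.
  rewrite ler_pdivrMr ?ltr0n // mul1r -(zr_nat 312) ler_zr.
  by apply/Z.leb_spec0; lia.
rewrite nth_default; last by rewrite (leq_trans _ hi).
have -> : zr 2890 = 2890 := zr_nat 2890.
have := musin_nonincreasing t0 t1 (lexx 1).
rewrite [musin (- 1)](_ : _ = 277 / 100); first lra.
by rewrite /musin; field.
Qed.

Implicit Types (e x y : 'rV[R]_3) (s : seq 'rV[R]_3) (l : seq Z).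

Fixpoint lincomb (a : seq Z) s : 'rV[R]_3 :=
  match a, s with
  | c :: a', x :: s' => zr c *: x + lincomb a' s'
  | _, _ => 0
  end.

Definition sep s := pairwise (fun x y => dotv x y <= 1 / 2) s.

Lemma lincomb_dotv_le a s x :
  size a = size s -> all (Z.leb 0) a -> all (fun y => dotv x y <= 1 / 2) s ->
  dotv x (lincomb a s) <= zr (sumZ a) / 2.
Proof.
elim: a s => [|c a IH] [|y s] //=.
  by move=> _ _ _; rewrite dotvC dot0v (zr_nat 0) mul0r.
move=> [sz] /andP[c0 ha] /andP[hy hs].
rewrite dotvC dotvDl dotvZl !(dotvC _ x) zrD.
have := IH s sz ha hs; rewrite -ler_zr (zr_nat 0) in c0.
by have := ler_wpM2l c0 hy; lra.
Qed.

(** Off-diagonal Gram entries are at most $1/2$ and weights are nonnegative; the induction splits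
    off one vector and bounds its cross terms by [lincomb_dotv_le]. *)
Lemma lincomb_sqr_le a s :
  size a = size s -> all (Z.leb 0) a -> all (fun y => dotv y y == 1) s -> sep s ->
  dotv (lincomb a s) (lincomb a s) <= (zr (dotZ a a) + zr (sumZ a) ^+ 2) / 2.
Proof.
elim: a s => [|c a IH] [|y s] //=.
  by move=> _ _ _ _; rewrite dot0v (zr_nat 0); lra.
move=> [sz] /andP[c0 ha] /andP[/eqP hy hs] /andP[ysep hsep].
have h1 := IH s sz ha hs hsep.
have h2 := lincomb_dotv_le sz ha ysep.
rewrite dotvDl dotvZl ![dotv _ (_ + _)]dotvC !dotvDl !dotvZl hy (dotvC (lincomb a s) y).
rewrite -ler_zr (zr_nat 0) in c0; have := ler_wpM2l c0 h2.
by rewrite !zrD zrM; lra.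
Qed.

Definition in_box w e l s :=
  all2 (fun k y => (zr k <= 312 * dotv e y) && (312 * dotv e y <= zr (Z.add k w))) l s.

Lemma lincomb_dotv_ge w e a l s :
  size a = size l -> all (Z.leb 0) a -> in_box w e l s ->
  zr (dotZ a l) <= 312 * dotv e (lincomb a s).
Proof.
elim: a l s => [|c a IH] [|k l] [|y s] //=.
  by move=> _ _ _; rewrite dotvC dot0v (zr_nat 0) mulr0.
move=> [sz] /andP[c0 ha] /andP[/andP[hk _] hs].
rewrite dotvC dotvDl dotvZl !(dotvC _ e) zrD zrM.
rewrite -ler_zr (zr_nat 0) in c0; have := ler_wpM2l c0 hk.
by have := IH l s sz ha hs; lra.
Qed.

Lemma in_box_size w e l s : in_box w e l s -> size l = size s.
Proof. by rewrite /in_box all2E => /andP[/eqP]. Qed.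

Lemma dotZ_ge0 a l : all (Z.leb 0) a -> all (Z.leb 0) l -> Z.le 0 (dotZ a l).
Proof. elim: a l => [|c a IH] [|k l] //= /andP[? /IH h] /andP[? /h ?]; nia. Qed.

Lemma gram_feasible w e l s :
  unitv e -> all (fun y => dotv y y == 1) s -> sep s -> all (Z.leb 0) l ->
  in_box w e l s -> ~~ gram_infeasible l.
Proof.
move=> he hs hsep l0 hbox; rewrite /gram_infeasible.
set a := gram_weights l.
have sz : size a = size l by rewrite size_map.
have a0 : all (Z.leb 0) a by apply/allP => z /mapP[k _ ->]; apply/Z.leb_spec0; lia.
have h1 := lincomb_dotv_ge sz a0 hbox.
have h2 := lincomb_sqr_le (etrans sz (in_box_size hbox)) a0 hs hsep.
have h3 := dotv_sqr_le (lincomb a s) he.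
(* Nonnegativity allows the lower bound [h1] to be squared before it meets Cauchy-Schwarz in
   [h3]. *)
have x0 : zr 0 <= zr (dotZ a l) by rewrite ler_zr; apply/Z.leb_spec0/dotZ_ge0.
rewrite (zr_nat 0) in x0.
rewrite -ltr_zr -leNgt !(zrM, zrD) (zr_nat 2) (zr_nat 312).
have h4 : zr (dotZ a l) ^+ 2 <= (312 * dotv e (lincomb a s)) ^+ 2.
  by rewrite ler_sqr ?nnegrE // (le_trans x0).
move: h1 h2 h3 h4 x0; lra.
Qed.

Lemma subboxes_cover h e l s : in_box (Z.mul 2 h) e l s ->
  exists2 c, c \in subboxes h l & in_box h e c s.
Proof.
elim: l s => [|k l IH] [|y s] //=; first by exists [::].
move=> /andP[/andP[k1 k2] /IH[c cin hc]].
case: (lerP (312 * dotv e y) (zr (Z.add k h))) => [hk|/ltW hk].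
  exists (k :: c); first by rewrite mem_cat map_f.
  by rewrite /= k1 hk.
exists (Z.add k h :: c); first by rewrite mem_cat map_f ?orbT.
rewrite /= hk hc andbT; move: k2.
by rewrite (_ : Z.add k (Z.mul 2 h) = Z.add (Z.add k h) h) //; lia.
Qed.

Lemma sorted_not_unsorted w e l s :
  sorted (fun x y => dotv e x <= dotv e y) s -> in_box w e l s -> ~~ unsorted w l.
Proof.
elim: l s => [|k l IH] [|y s] // hs /andP[/andP[k1 k2] hb].
rewrite [unsorted _ _]/= negb_or (IH s) ?(path_sorted hs) // andbT.
case: l s hs hb {IH} => [|k' l] [|y' s] //= /andP[hyy _] /andP[/andP[k1' k2'] _].
by rewrite -ltr_zr -leNgt; lra.
Qed.

Lemma subboxes_ge0 h l c : Z.le 0 h -> all (Z.leb 0) l -> c \in subboxes h l -> all (Z.leb 0) c.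
Proof.
move=> h0; elim: l c => [|k l IH] c; first by rewrite inE => _ /eqP->.
move=> /= /andP[k0 l0]; rewrite mem_cat => /orP[] /mapP[c' /(IH _ l0) hc' ->] /=.
  by rewrite k0.
by rewrite hc' andbT; apply/Z.leb_spec0; lia.
Qed.

Lemma Zpow2_ge0 n : Z.le 0 (Zpow2 n).
Proof. by elim: n => [|n IH] //; exact: Z.mul_nonneg_nonneg. Qed.

Lemma musin_sum_ub w e l s :
  all (fun y => (23 / 39 <= dotv e y) && (dotv e y <= 1)) s -> in_box w e l s ->
  1000 * \sum_(y <- s) musin (- dotv e y) <= zr (sumZ [seq musin_ub (Z.add k w) | k <- l]).
Proof.
elim: l s => [|k l IH] [|y s] //=.
  by move=> _ _; rewrite big_nil mulr0 (zr_nat 0).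
move=> /andP[/andP[y0 y1] hs] /andP[/andP[_ k2] hb].
by rewrite big_cons mulrDr zrD lerD ?IH ?musin_ub_ge.
Qed.

Lemma cap_check_sound n e l s :
  unitv e -> all (fun y => dotv y y == 1) s -> sep s ->
  all (fun y => (23 / 39 <= dotv e y) && (dotv e y <= 1)) s ->
  sorted (fun x y => dotv e x <= dotv e y) s ->
  all (Z.leb 0) l -> in_box (Zpow2 n) e l s -> cap_check n l ->
  \sum_(y <- s) musin (- dotv e y) < 289 / 100.
Proof.
move=> he hs hsep hcap hsort; elim: n l => [|n IH] l l0 hbox.
all: rewrite [cap_check _ _]/=; case: ifPn => [|_ hc]; rewrite // /pruned.
(* A box that contains an actual configuration passes the order and Gram tests, so only the sum test
   can have pruned it. *)
1,2: rewrite (negbTE (sorted_not_unsorted hsort hbox)).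
1,2: case: ifPn => [hsum _|_]; last by rewrite (negbTE (gram_feasible he hs hsep l0 hbox)).
1,2: rewrite -ltr_zr [zr 2890](zr_nat 2890) in hsum.
1,2: by have := le_lt_trans (musin_sum_ub hcap hbox) hsum; lra.
have [c cin cbox] := subboxes_cover (h := Zpow2 n) hbox.
have c0 : all (Z.leb 0) c := subboxes_ge0 (@Zpow2_ge0 n) l0 cin.
apply: (IH c) => //.
by move/allP: hc; apply.
Qed.

End Soundness.

(** * The kissing number *)

Section Kissing.
Variable R : realType.
Local Notation unitv := (@on_unit_sphere R 3).
Implicit Types (e x y : 'rV[R]_3) (s : seq 'rV[R]_3).

Lemma cap_sum_lt e s :
    unitv e -> uniq s -> (forall x, x \in s -> unitv x) ->
    (forall x y, x \in s -> y \in s -> x != y -> dotv x y <= 1 / 2) ->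
    (forall x, x \in s -> 23 / 39 <= dotv e x) ->
  \sum_(y <- s) musin (- dotv e y) < 289 / 100.
Proof.
move=> he us hs hsep hcap.
have s4 := cap_size_le4 he us hs hsep hcap.
(* Sorting by height justifies discarding the [unsorted] boxes. *)
pose le_e x y := dotv e x <= dotv e y.
have le_e_total : total le_e by move=> x y; exact: le_total.
have mem_s x : x \in sort le_e s = (x \in s) by rewrite mem_sort.
rewrite -(perm_big _ (permEl (perm_sort le_e s))) /=.
have : uniq (sort le_e s) by rewrite sort_uniq.
have := sort_sorted le_e_total s.
move: s4; rewrite -(size_sort le_e).
have {}hs x : x \in sort le_e s -> unitv x by rewrite mem_s; exact: hs.
have {}hcap x : x \in sort le_e s -> 23 / 39 <= dotv e x by rewrite mem_s; exact: hcap.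
have {}hsep x y : x \in sort le_e s -> y \in sort le_e s -> x != y -> dotv x y <= 1 / 2.
  by rewrite !mem_s; exact: hsep.
move: (sort le_e s) hs hcap hsep => {us mem_s}s hs hcap hsep s4 sorted_s us.
have [->|s0] := eqVneq s [::]; first by rewrite big_nil; lra.
have hbound y : y \in s -> 23 / 39 <= dotv e y <= 1.
  by move=> ys; rewrite hcap //=; have /andP[] := dotv_unit_itv he (hs y ys).
apply: (@cap_check_sound R 7%N e (nseq (size s) cap_lo)) => //.
- by apply/allP => y /hs /eqP.
- elim: s us hsep {hs hcap s4 sorted_s s0 hbound} => //= x s IH /andP[xs us] hsep.
  apply/andP; split.
    apply/allP => y ys; apply: hsep; rewrite ?mem_head // ?in_cons ?ys ?orbT //.
    by apply: contraNneq xs => ->.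
  by apply: IH => // y z ys zs; apply: hsep; rewrite in_cons ?ys ?zs orbT.
- by apply/allP.
- by elim: (size s).
- elim: s hbound {us hsep hs hcap s4 sorted_s s0} => // x s IH hbound.
  have /andP[x0 x1] := hbound x (mem_head x s).
  rewrite /in_box /= -/(in_box _ _ _ _) IH; last first.
    by move=> y ys; apply: hbound; rewrite in_cons ys orbT.
  rewrite andbT [zr _ cap_lo](zr_nat R 184) [zr _ _](zr_nat R 312).
  by apply/andP; split; lra.
have /allP := cap_check_le4; apply.
by move: s4 s0; rewrite -size_eq0; case: (size s) => [|[|[|[|[|]]]]].
Qed.

(** $13 = 10.11 + 2.89$: the diagonal term and the cap bound; every other term is nonpositive by
    [musin_le0]. *)
Lemma musin_row_sum_lt x s :
    uniq s -> (forall y, y \in s -> unitv y) ->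
    (forall y z, y \in s -> z \in s -> y != z -> dotv y z <= 1 / 2) ->
  x \in s -> \sum_(y <- s) musin (dotv x y) < 13.
Proof.
move=> us hs hsep xs; rewrite (bigD1_seq x) //= (hs x xs : dotv x x = 1) musin1.
pose e := (-1) *: x.
have eE y : dotv x y = - dotv e y by rewrite dotvZl mulN1r opprK.
have he : unitv e.
  by rewrite /on_unit_sphere dotvZl dotvC dotvZl (hs x xs : dotv x x = 1); lra.
rewrite (bigID (fun y => 23 / 39 <= dotv e y)) /=.
have out : \sum_(y <- s | (y != x) && ~~ (23 / 39 <= dotv e y)) musin (dotv x y) <= 0.
  rewrite big_seq_cond sumr_le0 // => y /andP[ys /andP[yx]]; rewrite -ltNge => hy.
  apply: musin_le0; first by rewrite eE; lra.
  by apply: hsep => //; rewrite eq_sym.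
suff : \sum_(y <- s | (y != x) && (23 / 39 <= dotv e y)) musin (dotv x y) < 289 / 100.
  by move: out; lra.
rewrite -big_filter; under eq_bigr do rewrite eE.
apply: cap_sum_lt => //; first exact: filter_uniq.
- by move=> y; rewrite mem_filter => /andP[_ /hs].
- by move=> y z; rewrite !mem_filter => /andP[_ ys] /andP[_ zs]; exact: hsep.
- by move=> y; rewrite mem_filter => /andP[/andP[_]].
Qed.

(** * Angles, inner products and the final count *)

Lemma cos_pi3 : cos (pi / 3) = 1 / 2 :> R.
Proof.
have pi0 := pi_gt0 R.
have c0 : 0 < cos (pi / 3 : R) by apply: cos_gt0_pihalf; apply/andP; split; lra.
have : cos (pi / 3 + (pi / 3 + pi / 3)) = -1 :> R.
  by rewrite -cospi; congr cos; field.
rewrite !cosD sinD.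
have := cos2Dsin2 (pi / 3 : R).
move: (cos _) (sin _) c0 => c d c0 h1 h2.
(* The triple angle formula for $\cos \pi = -1$ reads $4c^3 - 3c + 1 = 0$, which factors like this;
   $c > 0$ leaves $c = 1/2$. *)
have : (c + 1) * (2 * c - 1) ^+ 2 = 0.
  have -> : (c + 1) * (2 * c - 1) ^+ 2 =
     (c * (c * c - d * d) - d * (d * c + c * d)) + 1 + 3 * c * (c ^+ 2 + d ^+ 2 - 1) by ring.
  by rewrite h2 h1; ring.
by move/eqP; rewrite mulf_eq0 sqrf_eq0 => /orP[/eqP|/eqP]; lra.
Qed.

Lemma pi3_le_acos (t : R) : -1 <= t <= 1 -> (pi / 3 <= acos t) = (t <= 1 / 2).
Proof.
move=> ht; have pi0 := pi_gt0 R.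
rewrite !leNgt -[in RHS]cos_pi3 -[in RHS](acosK (x := t)) ?in_itv //=.
rewrite ltr_cos // in_itv /= ?acos_ge0 ?acos_lepi //.
by apply/andP; split; lra.
Qed.

Lemma kissing_config_size s : kissing_config 3 s -> (size s <= 12)%N.
Proof.
move=> [us [hs hang]].
have hsep y z : y \in s -> z \in s -> y != z -> dotv y z <= 1 / 2.
  move=> ys zs yz; rewrite -pi3_le_acos; first exact: hang.
  exact: dotv_unit_itv (hs y ys) (hs z zs).
have [->|s0] := eqVneq s [::]; first by [].
rewrite -ltnS -(ltr_nat R).
apply: (delsarte_bound us hs (@psd_musin R)) s0 => x xs.
exact: musin_row_sum_lt.
Qed.

(** The minimal vectors of the face-centred cubic lattice, of squared length 2. Integer coordinates
    reduce the checks on inner products to computation. *)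
Definition fcc_roots : seq (int * int * int) :=
  [:: (1, 1, 0); (1, -1, 0); (-1, 1, 0); (-1, -1, 0);
      (1, 0, 1); (1, 0, -1); (-1, 0, 1); (-1, 0, -1);
      (0, 1, 1); (0, 1, -1); (0, -1, 1); (0, -1, -1)].

Definition int3_dot (p q : int * int * int) : int :=
  p.1.1 * q.1.1 + p.1.2 * q.1.2 + p.2 * q.2.

Definition fcc_vec (p : int * int * int) : 'rV[R]_3 :=
  \row_i ((nth 0 [:: p.1.1; p.1.2; p.2] i)%:~R / Num.sqrt 2).

Lemma dotv_fcc_vec p q : dotv (fcc_vec p) (fcc_vec q) = (int3_dot p q)%:~R / 2.
Proof.
have sq2 : Num.sqrt 2 * Num.sqrt 2 = 2 :> R by rewrite -expr2 sqr_sqrtr ?ler0n.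
rewrite dotv3E /rvcoord !mxE !inordK //= /int3_dot !intrD !intrM -[in RHS]sq2.
by field; rewrite sqrtr_eq0 -ltNge ltr0n.
Qed.

Lemma fcc_config : kissing_config 3 [seq fcc_vec p | p <- fcc_roots].
Proof.
have huniq : uniq fcc_roots by [].
have hunit p : p \in fcc_roots -> unitv (fcc_vec p).
  have /allP h : all (fun p => int3_dot p p == 2) fcc_roots by [].
  move=> /h /eqP hp; rewrite /on_unit_sphere dotv_fcc_vec hp.
  by rewrite divff ?intr_eq0 //.
have hsep p q : p \in fcc_roots -> q \in fcc_roots -> p != q ->
    dotv (fcc_vec p) (fcc_vec q) <= 1 / 2.
  have /allP h : all (fun p => all (fun q => (p != q) ==> (int3_dot p q <= 1))
    fcc_roots) fcc_roots by [].
  move=> /h /allP hp /hp /implyP hpq /hpq h1.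
  by rewrite dotv_fcc_vec ler_pM2r ?invr_gt0 ?ltr0n // lerz1.
(* Distinct roots with equal images would have inner product both 1 and at most $1/2$. *)
split; first rewrite map_inj_in_uniq // => p q ps qs pq.
  apply/eqP/negPn/negP => npq; have := hsep p q ps qs npq.
  by rewrite pq (hunit q qs : dotv _ _ = 1); lra.
split=> [_ /mapP[p ps ->]|_ _ /mapP[p ps ->] /mapP[q qs ->] npq]; first exact: hunit.
rewrite /ang_dist pi3_le_acos; last exact: dotv_unit_itv (hunit p ps) (hunit q qs).
apply: hsep => //.
by apply: contraNneq npq => ->.
Qed.

End Kissing.

Theorem mainTheorem1 (R : realType) : @is_kissing_number R 3 12.
Proof.
split; last exact: kissing_config_size.
by exists [seq fcc_vec R p | p <- fcc_roots]; split; first exact: fcc_config.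
Qed.
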